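(* Let $n\ge 2$, let $N=\{1,\dots,n\}$ be the set of firms and let $V=\{1,\dots,v\}$ be the finite set of transport nodes (market locations). Let $f:\mathbb{R}\to\mathbb{R}$ be a nonnegative convex function that attains its minimum at $0$. Let $k_1,\dots,k_n\in\{0,1,\dots,n-1\}$ and set $f_i(x)=f(x-k_i)$ for $i\in N$. Suppose the $n$ firms compete in the spatial collaborative oligopoly in which, given a collaboration graph $g$ on $N$, the price at node $l\in V$ is $P_l(d_{l1},\dots,d_{ln})=\alpha_l-\sum_{i\in N}d_{li}$, the marginal production cost of firm $i$ is $c_i(g)=\gamma_0+f_i(\eta_i(g))$, and the marginal cost for firm $i$ of shipping to node $l$ is $s_{li}\ge 0$ (with $\alpha_l,\gamma_0,s_{li}\in\mathbb{R}$). Suppose that for every $l\in V$ $$\alpha_l-\gamma_0-n\Big[\max_{m\in V,\,i\in N}s_{mi}+\max\{f(n-1),f(1-n)\}\Big]-\tfrac12(n-1)\max\{f(1)-f(0),\,f(-1)-f(0)\}>0 .$$ Then every graph $g$ on $N$ with $\eta_i(g)=k_i$ for all $i\in N$ is a (pairwise) stable collaboration graph with respect to the allocation rule $Y_i(g)$ given by the equilibrium profits of this oligopoly.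
   Context: A collaboration graph $g$ is a simple undirected graph on the vertex set $N$, i.e. a set of two-element subsets $ij=\{i,j\}$ of $N$ (links). $\eta_i(g)$ is the degree of $i$ in $g$. For a link $ij\in g$, $g-ij$ is $g$ with the link $ij$ removed; for $ij\notin g$, $g+ij$ is $g$ with the link $ij$ added. Oligopoly: given $g$, each firm $i\in N$ simultaneously chooses quantities $d_{li}\ge 0$ for all $l\in V$ ($d_{li}$ is the quantity of firm $i$ delivered at node $l$) to maximize its own profit $$\sum_{l\in V}d_{li}\Big[\alpha_l-\sum_{j\in N}d_{lj}-s_{li}-\gamma_0-f_i(\eta_i(g))\Big].$$ The allocation $Y_i(g)$ is the profit of firm $i$ at the (unique) Nash (Cournot) equilibrium of this game. Pairwise stability: a graph $g$ is stable with respect to the allocation rule $Y$ if (1) for all $ij\in g$, $Y_i(g)\ge Y_i(g-ij)$ (for each of the two endpoints of the link); and (2) for all $ij\notin g$ (with $i\ne j$), if $Y_i(g+ij)>Y_i(g)$ then $Y_j(g+ij)<Y_j(g)$. *)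

(* Defs.v *)
From HB Require Import structures.
From mathcomp Require Import all_boot all_order all_algebra.
From mathcomp Require Import all_classical all_reals all_analysis.
From mathcomp Require Import lra.
Import Order.TTheory GRing.Theory Num.Theory.
Import numFieldNormedType.Exports.

Set Implicit Arguments.
Unset Strict Implicit.
Unset Printing Implicit Defensive.

Local Open Scope ring_scope.

Section Graphs.
Variable n : nat.
Implicit Types (g : {set {set 'I_n}}) (i j : 'I_n).

(* A graph is its set of links, each link being a two-element set of firms. *)
Definition is_graph g : bool := [forall e in g, #|e| == 2].

Definition degree g i : nat := #|[set e in g | i \in e]|.

Definition add_link g i j : {set {set 'I_n}} := [set i; j] |: g.

Definition del_link g i j : {set {set 'I_n}} := g :\ [set i; j].

(* Quantifying over ordered pairs (i, j) covers both endpoints of a link. *)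
Definition pairwise_stable (R : realType) (Y : {set {set 'I_n}} -> 'I_n -> R)
    g : Prop :=
  (forall i j, [set i; j] \in g -> Y (del_link g i j) i <= Y g i) /\
  (forall i j, i != j -> [set i; j] \notin g ->
     Y g i < Y (add_link g i j) i -> Y (add_link g i j) j < Y g j).

End Graphs.

Section Oligopoly.
Variables (R : realType) (n v : nat).
Variables (alpha : 'I_v -> R) (gamma0 : R) (s : 'I_v -> 'I_n -> R).
Variable F : 'I_n -> R -> R.
Implicit Types (g : {set {set 'I_n}}) (i j : 'I_n) (l : 'I_v).

(* In a profile d, the entry d l i is the quantity firm i delivers at node l. *)
Implicit Type d : 'M[R]_(v, n).

Definition price d l : R := alpha l - \sum_(i < n) d l i.

Definition production_cost g i : R := gamma0 + F i (degree g i)%:R.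

Definition profit g d i : R :=
  \sum_(l < v) d l i * (price d l - s l i - production_cost g i).

Definition feasible d : Prop := forall l i, 0 <= d l i.

Definition nash g d : Prop :=
  feasible d /\
  forall i d', feasible d' -> (forall l j, j != i -> d' l j = d l j) ->
    profit g d' i <= profit g d i.

(* Well defined by nash_exists_unique below; the default 0 is never used. *)
Definition equilibrium_profit g i : R :=
  profit g (xget 0 [set d | nash g d]%classic) i.

Let margin g l i : R := alpha l - s l i - production_cost g i.

Let best_replyP (A x : R) : 0 <= x ->
  (forall y, 0 <= y -> y * (A - y) <= x * (A - x)) <->
  x = Num.max 0 (A - x).
Proof.
move=> x0; split=> [H|E y y0].
  have [A0|A0] := leP 0 A.
    have hA : 0 <= A / 2 by lra.
    have h := H _ hA.
    have hs : (x - A / 2) ^+ 2 <= 0 by rewrite expr2; nra.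
    have : x - A / 2 = 0 by apply/eqP; rewrite -sqrf_eq0 eq_le hs sqr_ge0.
    move=> hx; rewrite max_r; lra.
  have h := H 0 (lexx _).
  have -> : x = 0 by apply/eqP; rewrite eq_le x0 andbT leNgt; apply/negP; nra.
  by rewrite subr0 max_l // ltW.
have := E; have [h ex|h ex] := leP (A - x) 0.
  rewrite ex in h *; nra.
have := sqr_ge0 (x - y); rewrite expr2; nra.
Qed.

Let profit_split g d d' i : (forall l j, j != i -> d' l j = d l j) ->
  profit g d' i = \sum_(l < v) d' l i *
    ((margin g l i - \sum_(j < n | j != i) d l j) - d' l i).
Proof.
move=> H; apply: eq_bigr => l _; congr (_ * _).
rewrite /price /margin (bigD1 i) //= (eq_bigr _ (fun j => H l j)); lra.
Qed.

Let nashP g d :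
  nash g d <->
  forall l i, d l i = Num.max 0 (margin g l i - \sum_(j < n) d l j).
Proof.
have eqQ l i : margin g l i - \sum_(j < n) d l j =
    (margin g l i - \sum_(j < n | j != i) d l j) - d l i.
  by rewrite (bigD1 i) //=; lra.
split=> [[d0 H] l i|H].
  rewrite eqQ; apply/(best_replyP _ (d0 l i)) => y y0.
  pose d' : 'M[R]_(v, n) :=
    \matrix_(a, b) if (a == l) && (b == i) then y else d a b.
  have d'0 : feasible d' by move=> a b; rewrite mxE; case: ifP.
  have d'E a b : b != i -> d' a b = d a b.
    by move=> /negbTE bi; rewrite mxE bi andbF.
  have := H i d' d'0 d'E.
  rewrite (profit_split _ d'E) (@profit_split g d d i) //.
  rewrite (bigD1 l) //= [leRHS](bigD1 l) //= mxE !eqxx /=.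
  rewrite (eq_bigr (fun a => d a i *
    ((margin g a i - \sum_(j < n | j != i) d a j) - d a i))) ?lerD2r //.
  by move=> a /negbTE al; rewrite mxE al.
have d0 : feasible d by move=> l i; rewrite H le_max lexx.
split=> // i d' d'0 d'E.
rewrite (profit_split _ d'E) (@profit_split g d d i) //.
apply: ler_sum => l _.
have e := H l i; rewrite eqQ in e.
exact: (proj2 (best_replyP _ (d0 l i)) e).
Qed.

Let fixpoint_exists (a : 'I_n -> R) :
  exists Q, Q = \sum_(i < n) Num.max 0 (a i - Q).
Proof.
pose h Q := Q - \sum_(i < n) Num.max 0 (a i - Q).
pose M := \sum_(i < n) Num.max 0 (a i).
have M0 : 0 <= M by apply: sumr_ge0 => i _; rewrite le_max lexx.
have ch : continuous h.
  move=> x; apply: cvgB; first exact: cvg_id.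
  apply: (@continuous_big _ _ _ _ _ _ _ _ (fun i Q => Num.max 0 (a i - Q))).
    exact: add_continuous.
  move=> i _ y; apply: (@continuous_max R R (fun=> 0) (fun Q => a i - Q)).
    exact: cvg_cst.
  by apply: cvgB; [exact: cvg_cst | exact: cvg_id].
have h0 : h 0 <= 0.
  rewrite /h sub0r oppr_le0; apply: sumr_ge0 => i _.
  by rewrite le_max lexx.
have hM : 0 <= h M.
  rewrite /h subr_ge0; apply: ler_sum => i _.
  by rewrite ge_max !le_max lexx /= [a i - M <= a i]gerBl M0 orbT.
have [||c _ hc] := @IVT R h 0 M 0 M0.
- exact: continuous_subspaceT.
- by rewrite ge_min le_max h0 hM orbT.
- by exists c; apply/eqP; rewrite -subr_eq0 -/(h c) hc.
Qed.

Let fixpoint_unique (a : 'I_n -> R) Q Q' :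
  Q = \sum_(i < n) Num.max 0 (a i - Q) ->
  Q' = \sum_(i < n) Num.max 0 (a i - Q') -> Q = Q'.
Proof.
have W P P' : P = \sum_(i < n) Num.max 0 (a i - P) ->
    P' = \sum_(i < n) Num.max 0 (a i - P') -> P <= P'.
  move=> e e'; rewrite leNgt; apply/negP => lt.
  suff : P <= P' by rewrite leNgt lt.
  rewrite [leLHS]e [leRHS]e'; apply: ler_sum => i _.
  have h : a i - P <= a i - P' by rewrite lerB // ltW.
  by rewrite ge_max !le_max lexx h orbT.
by move=> e e'; apply/eqP; rewrite eq_le !W.
Qed.

Lemma nash_exists_unique g : exists! d, nash g d.
Proof.
have [Q HQ] := choice (fun l => fixpoint_exists (margin g l)).
pose d : 'M[R]_(v, n) := \matrix_(l, i) Num.max 0 (margin g l i - Q l).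
have sd l : \sum_(j < n) d l j = Q l.
  by rewrite [RHS]HQ; apply: eq_bigr => i _; rewrite mxE.
exists d; split; first by apply/nashP => l i; rewrite sd mxE.
move=> d' /nashP H; apply/matrixP => l i.
rewrite mxE H; congr (Num.max 0 (_ - _)).
apply: (fixpoint_unique (HQ l)).
by apply: eq_bigr => j _; exact: H.
Qed.

End Oligopoly.

(* Main.v *)
Require Import Defs.
From HB Require Import structures.
From mathcomp Require Import all_boot all_order all_algebra.
From mathcomp Require Import all_classical all_reals all_analysis.
From mathcomp Require Import lra.
Import Order.TTheory GRing.Theory Num.Theory.
Import numFieldNormedType.Exports.
Local Open Scope ring_scope.

(** When every firm has its ideal degree, all production costs are at their
minimum [gamma0 + f 0]. Adding or deleting the link [ij] moves exactly the
degrees of [i] and [j], both by the same amount, so these two costs rise by the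
same [f 1 - f 0] or [f (-1) - f 0] and all others stay put. Hence no cost rises
by more than that of [i], and [lower_equilibrium_profit] says that such a shock
cannot benefit [i].

Its proof uses the first-order conditions alone ([nash_markup]): at an
equilibrium each delivery is the positive part of the firm's unit markup at that
node, so the equilibrium profit is the sum over the nodes of the squared
deliveries ([nash_profit]). If the cost of [i] rises by [delta], the most of all,
the price at a node cannot rise by more than [delta]: otherwise every markup
would rise, every firm would deliver at least as much, and the price would not
rise at all. So the markup of [i], hence its delivery, falls at every node. This
comparison treats firms that are active and inactive at a node alike. *)

Lemma degree_add_link (n : nat) (g : {set {set 'I_n}}) (i j m : 'I_n) :
  [set i; j] \notin g ->
  degree (add_link g i j) m = (degree g m + (m \in [set i; j]))%N.
Proof.
move=> gij; rewrite /degree /add_link.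
have [mij|mij] := boolP (m \in [set i; j]).
  have -> : [set e in [set i; j] |: g | m \in e] =
            [set i; j] |: [set e in g | m \in e].
    apply/setP => e; rewrite !inE; case: eqP => //= ->.
    by move: mij; rewrite !inE.
  by rewrite cardsU1 inE (negbTE gij) addnC.
rewrite addn0; congr #|pred_of_set _|; apply/setP => e.
by rewrite !inE; case: eqP => //= ->; rewrite (negbTE mij) andbF.
Qed.

Lemma degree_del_link (n : nat) (g : {set {set 'I_n}}) (i j m : 'I_n) :
  [set i; j] \in g ->
  degree g m = (degree (del_link g i j) m + (m \in [set i; j]))%N.
Proof.
move=> gij; rewrite -degree_add_link; last by rewrite !inE eqxx.
by rewrite /add_link /del_link finset.setD1K.
Qed.

(** A firm that delivers [x] at unit markup [m] has markup [m + x - y] after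
switching to [y]; it does not gain iff [0 <= (y - x) * (y - m)]. The midpoint of
[x] and [m] refutes this for [x <> m], unless [m < 0], where [y = 0] forces
[x = 0]. *)
Lemma optimal_delivery (R : realFieldType) (x m : R) : 0 <= x ->
  (forall y, 0 <= y -> y * (m + x - y) <= x * m) -> x = Num.max 0 m.
Proof.
move=> x0 opt; have [m0|m0] := leP 0 m.
  have y0 : 0 <= (x + m) / 2 by lra.
  have := opt _ y0; have := sqr_ge0 (x - m).
  rewrite expr2 => sq le_sq.
  have /eqP : (x - m) * (x - m) = 0 by nra.
  by rewrite mulf_eq0 orbb subr_eq0 => /eqP.
have := opt 0 (lexx _); rewrite mul0r => xm.
by nra.
Qed.

(** The price is [alpha] minus total delivery, so a price rise beyond the largest
cost rise [delta] raises all markups, hence all deliveries, and lowers the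
price. *)
Lemma price_rise_le (R : realDomainType) (n : nat) (alpha delta p p' : R)
    (c c' : 'I_n -> R) :
  p = alpha - \sum_(m < n) Num.max 0 (p - c m) ->
  p' = alpha - \sum_(m < n) Num.max 0 (p' - c' m) ->
  0 <= delta -> (forall m, c' m - c m <= delta) -> p' - p <= delta.
Proof.
move=> ep ep' delta0 rise; rewrite leNgt; apply/negP => lt.
suff : p' <= p by lra.
rewrite ep ep' lerD2l lerN2; apply: ler_sum => m _.
rewrite ge_max !le_max lexx /=; apply/orP; right.
by have := rise m; lra.
Qed.

Section Equilibrium.
Variables (R : realType) (n v : nat).
Variables (alpha : 'I_v -> R) (gamma0 : R) (s : 'I_v -> 'I_n -> R).
Variable F : 'I_n -> R -> R.
Implicit Types (g : {set {set 'I_n}}) (i m : 'I_n) (l : 'I_v) (d : 'M[R]_(v, n)).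

Let markup g d l i := price alpha d l - s l i - production_cost gamma0 F g i.

Lemma nash_markup g d l i :
  nash alpha gamma0 s F g d -> d l i = Num.max 0 (markup g d l i).
Proof.
move=> [d0 opt]; apply: optimal_delivery => // y y0.
(* Profit is separable across nodes, so it suffices to deviate at [l] alone. *)
pose d' : 'M[R]_(v, n) :=
  \matrix_(a, b) if (a == l) && (b == i) then y else d a b.
have d'0 : feasible d' by move=> a b; rewrite mxE; case: ifP.
have d'E a b : b != i -> d' a b = d a b.
  by move=> /negbTE bi; rewrite mxE bi andbF.
have price_l : price alpha d' l = price alpha d l + d l i - y.
  rewrite /price (bigD1 i) //= [in RHS](bigD1 i) //= mxE !eqxx /=.
  by rewrite (eq_bigr _ (fun b => d'E l b)); lra.
have := opt i d' d'0 d'E; rewrite /profit (bigD1 l) //= [leRHS](bigD1 l) //=.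
rewrite [X in _ + X <= _](_ : _ = \sum_(a < v | a != l)
    d a i * (price alpha d a - s a i - production_cost gamma0 F g i)); last first.
  apply: eq_bigr => a /negbTE al; rewrite /price mxE al /=.
  by under eq_bigr do rewrite mxE al.
rewrite lerD2r price_l mxE !eqxx /= /markup; congr (_ * _ <= _); lra.
Qed.

Lemma nash_profit g d i :
  nash alpha gamma0 s F g d ->
  profit alpha gamma0 s F g d i = \sum_(l < v) d l i ^+ 2.
Proof.
move=> nd; apply: eq_bigr => l _; rewrite -/(markup g d l i).
by rewrite (nash_markup _ _ l i nd); case: leP => // _; rewrite expr2 !mul0r.
Qed.

(** At each node the price rises by no more than the cost of [i], so the delivery
of [i] shrinks, and with it the square that the node contributes to its profit. *)
Lemma lower_equilibrium_profit g g' i :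
  let rise m := production_cost gamma0 F g' m - production_cost gamma0 F g m in
  0 <= rise i -> (forall m, rise m <= rise i) ->
  equilibrium_profit alpha gamma0 s F g' i <=
  equilibrium_profit alpha gamma0 s F g i.
Proof.
move=> rise rise0 riseM.
have nashE h : nash alpha gamma0 s F h
    (xget 0 [set d | nash alpha gamma0 s F h d]%classic).
  have [d [nd _]] := nash_exists_unique alpha gamma0 s F h.
  exact: (@xgetPex _ 0 [set d | nash alpha gamma0 s F h d]%classic (ex_intro _ d nd)).
rewrite /equilibrium_profit !nash_profit //.
move: (xget _ _) (nashE g) => d nd; move: (xget _ _) (nashE g') => d' nd'.
apply: ler_sum => l _; rewrite lerXn2r ?nnegrE ?nd.1 ?nd'.1 //.
rewrite (nash_markup _ _ l i nd) (nash_markup _ _ l i nd').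
rewrite ge_max !le_max lexx /=; apply/orP; right.
have priceE h e : nash alpha gamma0 s F h e -> price alpha e l = alpha l -
    \sum_(m < n) Num.max 0 (price alpha e l - (s l m + production_cost gamma0 F h m)).
  move=> ne; rewrite {1}/price; congr (_ - _); apply: eq_bigr => m _.
  by rewrite (nash_markup _ _ l m ne) /markup [in RHS]opprD addrA.
have le_rise m : s l m + production_cost gamma0 F g' m -
    (s l m + production_cost gamma0 F g m) <= rise i.
  by have := riseM m; rewrite /rise; lra.
have := price_rise_le _ _ _ _ _ _ _ _ (priceE _ _ nd) (priceE _ _ nd') rise0 le_rise.
by rewrite /markup /rise; lra.
Qed.

End Equilibrium.

Theorem theorem3p5 (R : realType) (n v : nat) (hn : (2 <= n)%N)
  (f : R -> R)
  (f_ge0 : forall x : R, 0 <= f x)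
  (f_convex : convex_function ([set: R]%classic : set R) f)
  (f_min0 : forall x : R, f 0 <= f x)
  (k : 'I_n -> nat) (hk : forall i : 'I_n, (k i <= n - 1)%N)
  (alpha : 'I_v -> R) (gamma0 : R) (s : 'I_v -> 'I_n -> R)
  (s_ge0 : forall (l : 'I_v) (i : 'I_n), 0 <= s l i)
  (hsize : forall l : 'I_v,
     0 < alpha l - gamma0
         - n%:R * (\big[Num.max/0]_(m < v) \big[Num.max/0]_(i < n) s m i
                   + Num.max (f (n%:R - 1)) (f (1 - n%:R)))
         - 2^-1 * (n%:R - 1) * Num.max (f 1 - f 0) (f (-1) - f 0))
  (g : {set {set 'I_n}}) (hg : is_graph g)
  (g_deg : forall i : 'I_n, degree g i = k i) :
  pairwise_stable
    (equilibrium_profit alpha gamma0 s (fun (i : 'I_n) (x : R) => f (x - (k i)%:R)))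
    g.
Proof.
set F := fun (i : 'I_n) (x : R) => f (x - (k i)%:R).
(* In both cases the endpoints move to [f x], with [x = -1] for a deletion and
   [x = 1] for an addition, and every other firm stays at the minimum [f 0]. *)
have harm g' i j x :
    (forall m, F m (degree g' m)%:R = if m \in [set i; j] then f x else f 0) ->
    equilibrium_profit alpha gamma0 s F g' i <=
    equilibrium_profit alpha gamma0 s F g i.
  move=> shock; have ideal m : F m (degree g m)%:R = f 0.
    by rewrite /F g_deg subrr.
  have f0x := f_min0 x.
  have iij : i \in [set i; j] by rewrite !inE eqxx.
  apply: lower_equilibrium_profit => [|m]; rewrite /production_cost !shock !ideal iij.
    lra.
  by case: ifP => _; lra.
split=> [i j gij|i j ij gij].
  apply: (harm _ i j (-1)) => m; rewrite /F -g_deg (degree_del_link n g i j m gij) natrD.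
  by case: (m \in _); congr f; rewrite /=; lra.
rewrite ltNge (harm _ i j 1) // => m.
rewrite /F -g_deg (degree_add_link n g i j m gij) natrD.
by case: (m \in _); congr f; rewrite /=; lra.
Qed.
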